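(* Let $A_1=\{2\text{-}13,21\text{-}3\}$, $A_2=\{2\text{-}31,23\text{-}1\}$, $A_3=\{1\text{-}32,13\text{-}2\}$, $A_4=\{3\text{-}12,31\text{-}2\}$. For every choice of $p_i\in A_i$ ($i=1,2,3,4$), if a permutation $\pi\in S_n(p_1,p_2,p_3,p_4)$ also avoids the pattern $1\text{-}23$, then $\pi=n\,(n-1)\ldots 2\,1$, and $|S_n(p_1,p_2,p_3,p_4,1\text{-}23)|=1$; that is, the permutations avoiding the five patterns $p_1,p_2,p_3,p_4,1\text{-}23$ are enumerated according to their length by the sequence $\{1\}_{n\ge1}$.
   Context: $S_n$ is the set of permutations $\pi=\pi_1\pi_2\cdots\pi_n$ of $\{1,\dots,n\}$ (written in one-line notation). For $abc$ a permutation of $123$, the generalized pattern $a\text{-}bc$ is contained in $\pi$ if there are indices $i<j$ with $j+1\le n$ such that $\pi_i\pi_j\pi_{j+1}$ is order-isomorphic to $abc$; the generalized pattern $ab\text{-}c$ is contained in $\pi$ if there are indices $i,k$ with $i+1<k\le n$ such that $\pi_i\pi_{i+1}\pi_k$ is order-isomorphic to $abc$. $\pi$ avoids a pattern if it does not contain it. $S_n(p_1,\dots,p_m)$ is the set of $\pi\in S_n$ avoiding all of $p_1,\dots,p_m$. The sequence $\{1\}_{n\ge1}$ is the constant sequence whose term is $1$ for every length $n\ge1$.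
   Formalization: The length n = 2 is excluded: both 12 and 21 avoid all five patterns there (no permutation of length 2 contains a pattern of length 3), so the claim and the count 1 fail for n = 2; the theorem covers every other n ≥ 1. *)

(* Defs.v *)
From mathcomp Require Import all_boot all_fingroup.

Set Implicit Arguments.
Unset Strict Implicit.
Unset Printing Implicit Defensive.

(* A permutation pi = pi_1 ... pi_n of {1, ..., n} is encoded as s : 'S_n, with
   positions and values both shifted to {0, ..., n - 1}: pi_(i + 1) = s i + 1. *)

Definition triple := (nat * nat * nat)%type.

Definition order_iso3 (u v : triple) : bool :=
  let: (x, y, z) := u in let: (a, b, c) := v in
  [&& (x < y) == (a < b), (y < x) == (b < a),
      (x < z) == (a < c), (z < x) == (c < a),
      (y < z) == (b < c) & (z < y) == (c < b)].

(* The boolean tells the two dash positions apart: false for a-bc, true for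
   ab-c. *)
Definition gpattern := (bool * triple)%type.
Definition a_bc (a b c : nat) : gpattern := (false, (a, b, c)).
Definition ab_c (a b c : nat) : gpattern := (true, (a, b, c)).

Definition contains (n : nat) (s : 'S_n) (p : gpattern) : bool :=
  let: (dash_last, w) := p in
  [exists i : 'I_n, exists j : 'I_n, exists k : 'I_n,
    [&& (if dash_last then (j == i.+1 :> nat) && (j < k)
         else (i < j) && (k == j.+1 :> nat))
      & order_iso3 (s i : nat, s j : nat, s k : nat) w]].

Definition avoids (n : nat) (s : 'S_n) (p : gpattern) : bool :=
  ~~ contains s p.

Definition avoiders (n : nat) (ps : seq gpattern) : {set 'S_n} :=
  [set s : 'S_n | all (avoids s) ps].

Definition A1 : seq gpattern := [:: a_bc 2 1 3; ab_c 2 1 3].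
Definition A2 : seq gpattern := [:: a_bc 2 3 1; ab_c 2 3 1].
Definition A3 : seq gpattern := [:: a_bc 1 3 2; ab_c 1 3 2].
Definition A4 : seq gpattern := [:: a_bc 3 1 2; ab_c 3 1 2].

(* pi = n (n-1) ... 2 1; rev_ord i has value n - i.+1. *)
Definition is_decreasing_word (n : nat) (s : 'S_n) : Prop :=
  forall i : 'I_n, s i = rev_ord i.

(* Main.v *)
Require Import Defs.
From mathcomp Require Import all_boot all_fingroup.
From mathcomp Require Import zify.

(* On three consecutive positions the two dash placements of a pattern coincide,
   so the five patterns exclude every order type but 321 there; for n >= 3 each
   adjacent pair lies in such a window, hence every step is a descent. *)

Lemma avoids_window {n : nat} {s : 'S_n} {p : gpattern} {i j k : 'I_n} :
  avoids s p -> j = i.+1 :> nat -> k = j.+1 :> nat ->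
  ~~ order_iso3 (s i : nat, s j : nat, s k : nat) p.2.
Proof.
case: p => b w /= av ji kj; apply: contra av => iso.
apply/existsP; exists i; apply/existsP; exists j; apply/existsP; exists k.
by apply/andP; split=> //; case: {iso} b; apply/andP; split; lia.
Qed.

(** Along descents [s j + j] never increases. It is at most n - 1 at the first position and at least
    n - 1 at the last, so it equals n - 1 throughout. *)
Lemma is_decreasing_word_descents (n : nat) (s : 'S_n) :
  (forall i j : 'I_n, j = i.+1 :> nat -> s j < s i) -> is_decreasing_word s.
Proof.
move=> desc i.
have hi : forall m (j : 'I_n), j = m :> nat -> s j + j < n.
  elim=> [|m IHm] j jm; first by have := ltn_ord (s j); lia.
  have m_lt : m < n by have := ltn_ord j; lia.
  have := IHm (Ordinal m_lt) erefl; have := desc (Ordinal m_lt) j jm.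
  by rewrite /=; lia.
(* Here [m] counts the positions after [j], so the induction runs backwards from the last
   position. *)
have lo : forall m (j : 'I_n), n = m + j.+1 -> n <= s j + j.+1.
  elim=> [|m IHm] j nm; first by lia.
  have j_lt : j.+1 < n by lia.
  have nm' : n = m + (Ordinal j_lt).+1 by rewrite /=; lia.
  by have := IHm _ nm'; have := desc j (Ordinal j_lt) erefl; rewrite /=; lia.
have nE : n = n - i.+1 + i.+1 by have := ltn_ord i; lia.
by apply: val_inj => /=; have := hi _ i erefl; have := lo _ i nE; lia.
Qed.

(** Either dash placement forces i < j < k, and a decreasing word shows the order type 321 on any
    such positions. *)
Lemma decreasing_word_avoids (n : nat) (s : 'S_n) (d : bool) (a b c : nat) :
  is_decreasing_word s -> ~~ ((c < b) && (b < a)) -> avoids s (d, (a, b, c)).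
Proof.
move=> dec; apply: contra => /existsP[i /existsP[j /existsP[k /andP[pos iso]]]].
have [ij jk] : i < j /\ j < k by case: d pos => /andP[]; lia.
move: iso; rewrite !dec /=.
have ltk := ltn_ord k.
have -> : (n - j.+1 < n - i.+1) = true by lia.
have -> : (n - k.+1 < n - j.+1) = true by lia.
by case/and5P=> _ /eqP <- _ _ /andP[_ /eqP <-].
Qed.

Theorem mainTheorem12 (p1 p2 p3 p4 : gpattern)
    (hp1 : p1 \in A1) (hp2 : p2 \in A2) (hp3 : p3 \in A3) (hp4 : p4 \in A4)
    (n : nat) (n_gt0 : 0 < n) (n_neq2 : n <> 2) :
  (forall s : 'S_n, s \in avoiders n [:: p1; p2; p3; p4] ->
     avoids s (a_bc 1 2 3) -> is_decreasing_word s) /\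
  #|avoiders n [:: p1; p2; p3; p4; a_bc 1 2 3]| = 1.
Proof.
have e1 : p1.2 = (2, 1, 3) by move: hp1; rewrite !inE => /orP[] /eqP ->.
have e2 : p2.2 = (2, 3, 1) by move: hp2; rewrite !inE => /orP[] /eqP ->.
have e3 : p3.2 = (1, 3, 2) by move: hp3; rewrite !inE => /orP[] /eqP ->.
have e4 : p4.2 = (3, 1, 2) by move: hp4; rewrite !inE => /orP[] /eqP ->.
have dec : forall s : 'S_n, s \in avoiders n [:: p1; p2; p3; p4] ->
    avoids s (a_bc 1 2 3) -> is_decreasing_word s.
  move=> s; rewrite inE /= => /and5P[av1 av2 av3 av4 _] av5.
  have window (i j k : 'I_n) : j = i.+1 :> nat -> k = j.+1 :> nat ->
      s k < s j /\ s j < s i.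
    move=> ji kj.
    have := avoids_window av1 ji kj; have := avoids_window av2 ji kj.
    have := avoids_window av3 ji kj; have := avoids_window av4 ji kj.
    have := avoids_window av5 ji kj; rewrite e1 e2 e3 e4 /=.
    (* Injectivity of [s] rules out ties. Six strict orders remain, and each of the five avoidances
       removes one, leaving 321. *)
    have neq (x y : 'I_n) : x <> y :> nat -> s x <> s y :> nat.
      by move=> xy /val_inj/perm_inj sxy; apply: xy; rewrite sxy.
    have := neq i j ltac:(lia); have := neq j k ltac:(lia).
    have := neq i k ltac:(lia).
    case: (ltngtP (s i) (s j)) => //; case: (ltngtP (s j) (s k)) => //;
      case: (ltngtP (s i) (s k)) => //; lia.
  apply: is_decreasing_word_descents => i j ji.
  have [k_lt | n_le] := ltnP j.+1 n.
    by have [] := window i j (Ordinal k_lt) ji erefl.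
  (* The pair ends the word, so the window must start one place earlier. Since n <> 2, [i] is not
     the first position and [i.-1] is its true predecessor. For n = 2 there is no window, and 12
     avoids every pattern of length three. *)
  have h_lt : i.-1 < n by have := ltn_ord i; lia.
  have ih : i = (Ordinal h_lt).+1 :> nat by have := ltn_ord j; rewrite /=; lia.
  by have [] := window _ i j ih ji.
split=> //.
have [r rE] : exists r : 'S_n, is_decreasing_word r.
  by exists (perm rev_ord_inj) => i; rewrite permE.
apply/eqP/cards1P; exists r; apply/setP => s; rewrite !inE.
apply/idP/eqP => [/= /and5P[av1 av2 av3 av4 /andP[av5 _]] | ->].
  apply/permP => i; rewrite rE; apply: dec => //.
  by rewrite inE /= av1 av2 av3 av4.
(* Only the order types are kept: none of the five is 321, so the dash placements can stay
   arbitrary. *)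
clear dec hp1 hp2 hp3 hp4; move: e1 e2 e3 e4.
by case: p1 p2 p3 p4 =>
  [d1 w1] [d2 w2] [d3 w3] [d4 w4] /= -> -> -> ->; rewrite !decreasing_word_avoids.
Qed.
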